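(* Let $X$ be a reflexive real Banach space and $Y$ a real Hilbert space with scalar product $(\cdot,\cdot)_Y$ and induced norm $\|\cdot\|_Y$. Let $a\colon X\times Y\to\mathbb R$ be a continuous bilinear form, let $L\colon Y\to\mathbb R$ be a continuous linear functional with $L\neq 0$, and let $P\subset X$ be a closed convex set with $0_X\in P$. Suppose that there are a closed, convex and bounded set $P_A\subset X$ and a closed convex cone $P_C\subset P$ such that every $x\in P$ can be written as $x=x_A+x_C$ with $x_A\in P_A$, $x_C\in P_C$, and suppose that $$\inf_{\substack{x_C\in P_C\\ x_C\neq 0_X}}\ \sup_{\substack{y\in Y\\ y\neq 0_Y}}\ \frac{a(x_C,y)}{\|x_C\|_X\|y\|_Y}=c_*>0 .$$ Then $\lambda^*=\zeta^*$, where $$\lambda^*:=\sup_{x\in P}\ \inf_{\substack{y\in Y\\ L(y)=1}} a(x,y),\qquad \zeta^*:=\inf_{\substack{y\in Y\\ L(y)=1}}\ \sup_{x\in P} a(x,y).$$ Moreover, if $\lambda^*<+\infty$, then the dual problem has a solution, i.e. there exists $\bar x\in P$ such that $a(\bar x,y)=\lambda^*L(y)$ for all $y\in Y$.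
   Context: All cones have their vertex at zero. The quantities $\lambda^*,\zeta^*$ take values in $[0,+\infty]$; one always has $0\le\lambda^*\le\zeta^*\le+\infty$, and $\lambda^*=\sup\{\lambda\in\mathbb R_+ : P\cap\Lambda_\lambda\neq\emptyset\}$ with $\Lambda_\lambda=\{x\in X : a(x,y)=\lambda L(y)\ \forall y\in Y\}$, where $\mathbb R_+=[0,+\infty)$. *)

(* Defs.v *)
From HB Require Import structures.
From mathcomp Require Import all_boot all_order all_algebra.
From mathcomp Require Import all_classical all_reals.
From mathcomp Require Import ereal topology normedtype convex.

Set Implicit Arguments.
Unset Strict Implicit.
Unset Printing Implicit Defensive.

Import Order.TTheory GRing.Theory Num.Theory.
Import numFieldNormedType.Exports.

Local Open Scope classical_set_scope.
Local Open Scope ring_scope.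

Section topological_dual.
Context {R : realType} (X : normedModType R).

Definition cdual_pred : {pred X -> R^o} :=
  mem [set f : X -> R^o | linear f /\ continuous f].

Lemma cdual_submod_closed : submod_closed cdual_pred.
Proof.
split=> [|a f g]; rewrite !inE /=.
  split=> [b x y|x]; last exact: cvg_cst.
  by rewrite -[LHS]/(0 : R^o) -[(0 : X -> R^o) x]/(0 : R^o)
    -[(0 : X -> R^o) y]/(0 : R^o) scaler0 addr0.
move=> [lf cf] [lg cg]; split=> [b x y|x].
  rewrite -![(a *: f + g) _]/(a *: f _ + g _) lf lg !scalerDr.
  by rewrite !scalerA [a * b]mulrC addrACA.
by apply: (@cvgD _ R^o); [apply: (@cvgZl_tmp _ R^o); exact: cf|exact: cg].
Qed.

HB.instance Definition _ :=
  GRing.isSubmodClosed.Build R (X -> R^o) cdual_pred cdual_submod_closed.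

Record cdual := CDual {
  cdual_fun :> X -> R^o;
  cdual_funP : cdual_fun \in cdual_pred }.

HB.instance Definition _ := [isSub for cdual_fun].
HB.instance Definition _ := [Choice of cdual by <:].
HB.instance Definition _ := [SubChoice_isSubLmodule of cdual by <:].

Definition cdual_norm (f : cdual) : R :=
  sup [set `|f x| | x in [set x : X | `|x| <= 1]].

Lemma cdual_linear (f : cdual) a x y : f (a *: x + y) = a * f x + f y.
Proof. by move: (valP f); rewrite inE => -[lf _]; exact: lf. Qed.

Lemma cdualD (f g : cdual) x : (f + g) x = f x + g x.
Proof. by []. Qed.

Lemma cdualZ a (f : cdual) x : (a *: f) x = a * f x.
Proof. by []. Qed.

Lemma cdual0r (f : cdual) : f 0 = 0.
Proof.
have := cdual_linear f 1 0 0.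
rewrite scale1r mul1r addr0 => /eqP.
by rewrite -subr_eq0 opprD addNKr oppr_eq0 => /eqP.
Qed.

Lemma cdualZr (f : cdual) a x : f (a *: x) = a * f x.
Proof. by have := cdual_linear f a x 0; rewrite !addr0 cdual0r addr0. Qed.

Lemma cdual_has_sup (f : cdual) :
  has_sup [set `|f x| | x in [set x : X | `|x| <= 1]].
Proof.
split; first by exists `|f 0|, 0 => //=; rewrite normr0.
move: (valP f); rewrite inE => -[lf cf].
pose F : {linear X -> R^o} := HB.pack (val f) (GRing.isLinear.Build _ _ _ _ _ lf).
have /linear_boundedP/pinfty_ex_gt0[M M0 HM] : bounded_near F (nbhs (0 : X)).
  by apply/linear_bounded_continuous => x; exact: cf.
exists M => _ [x /= x1 <-]; apply: (le_trans (HM x)).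
by rewrite -[leRHS]mulr1 ler_pM2l.
Qed.

Lemma cdual_norm_ub (f : cdual) x : `|x| <= 1 -> `|f x| <= cdual_norm f.
Proof. by move=> x1; apply: ub_le_sup; [case: (cdual_has_sup f)|exists x]. Qed.

Lemma cdual_norm_le (f : cdual) M :
  (forall x, `|x| <= 1 -> `|f x| <= M) -> cdual_norm f <= M.
Proof.
move=> H; apply: ge_sup; first by case: (cdual_has_sup f).
by move=> _ [x /= x1 <-]; exact: H.
Qed.

Lemma cdual_ler_normD (f g : cdual) :
  cdual_norm (f + g) <= cdual_norm f + cdual_norm g.
Proof.
apply: cdual_norm_le => x x1; rewrite cdualD (le_trans (ler_normD _ _))//.
by apply: lerD; exact: cdual_norm_ub.
Qed.

Lemma cdual_normrZ_le a (f : cdual) : cdual_norm (a *: f) <= `|a| * cdual_norm f.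
Proof.
apply: cdual_norm_le => x x1; rewrite cdualZ normrM.
by rewrite ler_wpM2l// cdual_norm_ub.
Qed.

Lemma cdual_normrZ a (f : cdual) : cdual_norm (a *: f) = `|a| * cdual_norm f.
Proof.
apply/eqP; rewrite eq_le cdual_normrZ_le /=.
have [->|a0] := eqVneq a 0.
  rewrite normr0 mul0r (le_trans (normr_ge0 ((0 *: f) 0)))//.
  by rewrite cdual_norm_ub// normr0.
rewrite -ler_pdivlMl ?normr_gt0// -normfV.
by have := cdual_normrZ_le a^-1 (a *: f); rewrite scalerA mulVf// scale1r.
Qed.

Lemma cdual_normr0_eq0 (f : cdual) : cdual_norm f = 0 -> f = 0.
Proof.
move=> f0; apply/val_inj/funext => x; change (f x = 0).
have [->|x0] := eqVneq x 0; first exact: cdual0r.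
have nx0 : `|x| != 0 by rewrite normr_eq0.
have : `|f (`|x|^-1 *: x)| <= 0.
  by rewrite -f0 cdual_norm_ub// normrZ normfV normr_id mulVf.
rewrite normr_le0 cdualZr mulf_eq0 invr_eq0 (negbTE nx0) /=.
exact: eqP.
Qed.

HB.instance Definition _ := Lmodule_isNormed.Build R cdual
  cdual_ler_normD cdual_normrZ cdual_normr0_eq0.

Lemma cdual_normE (f : cdual) :
  `|f| = sup [set `|f x| | x in [set x : X | `|x| <= 1]].
Proof. by []. Qed.

End topological_dual.

(* Surjectivity of the canonical embedding of X into its bidual. *)
Definition reflexive_space (R : realType) (X : normedModType R) : Prop :=
  forall phi : cdual (cdual X), exists x : X, forall f : cdual X, phi f = f x.

(* Vertex at the origin, which belongs to every nonempty cone. *)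
Definition cone (R : realType) (X : lmodType R) (C : set X) : Prop :=
  forall (t : R) (x : X), 0 <= t -> C x -> C (t *: x).

Section minimax.
Context {R : realType} (X Y : normedModType R).
Local Open Scope ereal_scope.

Definition lambda_star (a : X -> Y -> R) (L : Y -> R) (P : set X) : \bar R :=
  ereal_sup [set ereal_inf [set (a x y)%:E | y in [set y | L y = 1%R]] | x in P].

Definition zeta_star (a : X -> Y -> R) (L : Y -> R) (P : set X) : \bar R :=
  ereal_inf [set ereal_sup [set (a x y)%:E | x in P] | y in [set y | L y = 1%R]].

(* As usual inf of the empty set is +oo, so the constant is +oo for C = {0}. *)
Definition infsup_const (a : X -> Y -> R) (C : set X) : \bar R :=
  ereal_inf [set ereal_sup [set (a x y / (`|x| * `|y|))%:E | y in [set~ 0%R]]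
            | x in C `\ 0%R].

End minimax.

(* Main.v *)
(* For a real l with 0 <= l <= zeta_star, Riesz representation turns the
   requirement "a x = l L" into "T x = l e" with T : X -> Y linear and bounded.
   The set T(P) is closed: the inf-sup condition bounds the cone parts of
   preimages of a convergent sequence, and in a reflexive space bounded preimages
   have a weak limit, which stays in the closed convex set P by Hahn-Banach.
   Projecting l e on T(P) leaves a residual w; a nonzero w would satisfy L w > 0
   and sup over x in P of a x (w / L w) < l, contradicting l <= zeta_star.  Hence
   every such l is attained in P, so zeta_star <= lambda_star.

   Hahn-Banach is obtained from the fact that a pointwise minimal sublinear
   functional is linear, which only needs Zorn's lemma on total functionals. *)
Require Import Defs.
From HB Require Import structures.
From mathcomp Require Import all_boot all_order all_algebra.
From mathcomp Require Import all_classical all_reals.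
From mathcomp Require Import ereal topology normedtype convex.
From mathcomp Require Import ring lra.

Set Implicit Arguments.
Unset Strict Implicit.
Unset Printing Implicit Defensive.

Import Order.TTheory GRing.Theory Num.Theory.
Import numFieldNormedType.Exports.

Local Open Scope classical_set_scope.
Local Open Scope ring_scope.

(** * Sublinear functionals and the Hahn-Banach theorem *)

Definition sublinear (R : realType) (X : lmodType R) (p : X -> R) :=
  (forall x y, p (x + y) <= p x + p y) /\
  (forall t x, 0 < t -> p (t *: x) <= t * p x).

Section sublinear_theory.
Context {R : realType} {X : lmodType R}.
Implicit Types p q : X -> R.

Lemma sublinear0 p : sublinear p -> p 0 = 0.
Proof.
move=> [pD pZ]; apply/eqP; rewrite eq_le; apply/andP; split.
  have := pZ 2^-1 0; rewrite scaler0 => /(_ ltac:(by [])); lra.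
by have := pD 0 0; rewrite addr0; lra.
Qed.

Lemma sublinearN p x : sublinear p -> - p (- x) <= p x.
Proof.
by move=> pS; have [pD _] := pS; have := pD x (- x); rewrite subrr sublinear0//; lra.
Qed.

Section infimum.
Context {I : Type} (D : set I) (F : I -> X -> R).

(** The real-valued [inf] is the true infimum only for nonempty sets bounded below, which the
    hypotheses [D0] and [F_lb] guarantee. *)
Definition inf_family (x : X) : R := inf [set F i x | i in D].

Hypothesis D0 : D !=set0.
Hypothesis F_lb : forall x, has_lbound [set F i x | i in D].

Lemma inf_family_le i x : D i -> inf_family x <= F i x.
Proof. by move=> Di; apply: ge_inf => //; exists i. Qed.

Lemma le_inf_family c x : (forall i, D i -> c <= F i x) -> c <= inf_family x.
Proof.
move=> H; apply: lb_le_inf; first by case: D0 => i Di; exists (F i x), i.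
by move=> _ [i Di <-]; exact: H.
Qed.

(** The index may change under sums and dilations. This covers rays (indices add), chains (the
    smaller functional serves) and cones over convex sets alike. *)
Lemma inf_family_sublinear :
  (forall i j x y, D i -> D j -> exists2 k, D k & F k (x + y) <= F i x + F j y) ->
  (forall i t x, D i -> 0 < t -> exists2 k, D k & F k (t *: x) <= t * F i x) ->
  sublinear inf_family.
Proof.
move=> FD FZ; split=> [x y|t x t0].
  rewrite -lerBlDr; apply: le_inf_family => i Di.
  rewrite lerBlDr -lerBlDl; apply: le_inf_family => j Dj.
  have [k Dk Fk] := FD i j x y Di Dj.
  by rewrite lerBlDl; exact: le_trans (inf_family_le _ Dk) Fk.
rewrite -ler_pdivrMl//; apply: le_inf_family => i Di.
rewrite ler_pdivrMl//; have [k Dk Fk] := FZ i t x Di t0.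
exact: le_trans (inf_family_le _ Dk) Fk.
Qed.

End infimum.

(* The infimum of p (x + t h) - t p h over t >= 0. *)
Lemma sublinear_ray p h : sublinear p ->
  exists r, [/\ sublinear r, forall x, r x <= p x & r (- h) <= - p h].
Proof.
move=> pS; have [pD pZ] := pS.
pose F (t : R) x := p (x + t *: h) - t * p h.
pose D := [set t : R | 0 <= t].
have Flb x : has_lbound [set F t x | t in D].
  (* Subadditivity gives [p (t *: h) <= p (x + t *: h) + p (- x)], and homogeneity with factor
     [t^-1] gives [t * p h <= p (t *: h)]. *)
  exists (- p (- x)) => _ [t t0 <-]; rewrite /F.
  have := pD (x + t *: h) (- x); rewrite addrAC subrr add0r.
  have [->|tn0] := eqVneq t 0; first by rewrite scale0r sublinear0//; lra.
  have tp : 0 < t by rewrite lt_neqAle eq_sym tn0.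
  have := pZ t^-1 (t *: h); rewrite invr_gt0 tp => /(_ isT).
  by rewrite scalerA mulVf// scale1r -ler_pdivrMl ?invr_gt0// invrK; lra.
have D0 : D 0 by rewrite /D /=.
have D1 : D 1 by rewrite /D /=.
exists (inf_family D F); split => [|x|].
- apply: inf_family_sublinear => //; first by exists 0.
    move=> i j x y i0 j0; exists (i + j); first exact: addr_ge0.
    have := pD (x + i *: h) (y + j *: h).
    by rewrite /F scalerDl addrACA; lra.
  move=> i t x i0 t0; exists (t * i); first by apply: mulr_ge0 => //; exact: ltW.
  have := pZ t (x + i *: h) t0.
  by rewrite /F scalerDr scalerA; lra.
- have := inf_family_le Flb x D0.
  by rewrite /F scale0r addr0 mul0r subr0.
- have := inf_family_le Flb (- h) D1.
  by rewrite /F scale1r addNr sublinear0// mul1r sub0r.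
Qed.

(** The ray functional in direction [h] lies below [q], so minimality identifies it with [q] and
    [q (- h) <= - q h]. Oddness then turns both sublinearity inequalities into equalities. *)
Lemma minimal_sublinear_linear q : sublinear q ->
  (forall r, sublinear r -> (forall x, r x <= q x) -> r = q) -> linear (q : X -> R^o).
Proof.
move=> qS qmin; have [qD qZ] := qS.
have qN h : q (- h) = - q h.
  have [r [rS rq rh]] := sublinear_ray h qS.
  apply/eqP; rewrite eq_le -{1}(qmin r)// rh /=.
  by have := sublinearN h qS; lra.
have qDE x y : q (x + y) = q x + q y.
  apply/eqP; rewrite eq_le qD /=.
  by have := qD (- x) (- y); rewrite -opprD !qN; lra.
have qZp t x : 0 < t -> q (t *: x) = t * q x.
  move=> t0; apply/eqP; rewrite eq_le qZ//=.
  by have := qZ t (- x) t0; rewrite scalerN !qN; lra.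
move=> t x y; rewrite -[LHS]/(q (t *: x + y)) qDE; congr (_ + _).
have [t0|t0|<-] := ltgtP 0 t.
- exact: qZp.
- rewrite -[t]opprK scaleNr qN qZp ?oppr_gt0//.
  by rewrite -[RHS]/(- - t * q x) mulNr.
- by rewrite scale0r sublinear0// -[RHS]/(0 * _) mul0r.
Qed.

Lemma minimal_sublinear_ex p : sublinear p -> exists q, [/\ sublinear q,
  forall x, q x <= p x &
  forall r, sublinear r -> (forall x, r x <= q x) -> r = q].
Proof.
move=> pS; pose T := {q : X -> R | sublinear q /\ forall x, q x <= p x}.
(* The order is reversed, so that a maximal element in Zorn's lemma is a minimal functional. *)
pose le (q r : T) := `[< forall x, sval r x <= sval q x >].
have leP (q r : T) : le q r <-> forall x, sval r x <= sval q x.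
  by split=> [/asboolP|?]//; exact/asboolP.
have lb (q : T) x : - p (- x) <= sval q x.
  case: q => q [qS qp] /=; apply: le_trans (sublinearN x qS).
  by rewrite lerN2.
have : exists q : T, forall r, le q r -> r = q.
  apply: Zorn.
  - by move=> q; apply/leP.
  - move=> r s t /leP rs /leP st; apply/leP => x.
    exact: le_trans (st x) (rs x).
  - move=> [s sP] [t tP] /leP/= st /leP/= ts.
    have stE : s = t by apply/funext => x; apply/eqP; rewrite eq_le ts st.
    by case: _ / stE tP {st ts} => tP; congr exist; exact: Prop_irrelevance.
  (* An empty chain is bounded by [p]; a nonempty one by its pointwise infimum, finite since every
     member is at least [- p (- x)] at [x]. *)
  move=> A Atot; have [[q0 Aq0]|A0] := pselect (A !=set0); last first.
    exists (exist _ p (conj pS (fun=> lexx _))) => q Aq.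
    by exfalso; apply: A0; exists q.
  pose F (q : T) := sval q.
  have Flb x : has_lbound [set F q x | q in A].
    by exists (- p (- x)) => _ [q _ <-]; exact: lb.
  have AE : A !=set0 by exists q0.
  have infS : sublinear (inf_family A F).
    apply: inf_family_sublinear => //.
      move=> i j x y Ai Aj; have [|] := Atot i j Ai Aj => /leP ij.
      + exists j => //; have [jD _] := (svalP j).1; apply: le_trans (jD _ _) _.
        by rewrite lerD2r.
      + exists i => //; have [iD _] := (svalP i).1; apply: le_trans (iD _ _) _.
        by rewrite lerD2l.
    move=> i t x Ai t0; exists i => //.
    by have [_ iZ] := (svalP i).1; exact: iZ.
  have infp x : inf_family A F x <= p x.
    exact: le_trans (inf_family_le Flb x Aq0) ((svalP q0).2 x).
  exists (exist _ (inf_family A F) (conj infS infp)) => q Aq; apply/leP => x /=.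
  exact: inf_family_le.
case=> -[q [qS qp]] qmin; exists q; split=> // r rS rq.
have rp x : r x <= p x by exact: le_trans (rq x) (qp x).
pose r' : T := exist _ r (conj rS rp).
have -> // : r = sval r' by [].
by rewrite (qmin r')//; apply/leP.
Qed.

(** A minimal functional below the ray functional of [x0] satisfies [f (- x0) <= - p x0], which
    forces [p x0 <= f x0]. *)
Lemma hahn_banach_sublinear p x0 : sublinear p -> exists f : X -> R,
  [/\ linear (f : X -> R^o), forall x, f x <= p x & p x0 <= f x0].
Proof.
move=> pS; have [r [rS rp rx0]] := sublinear_ray x0 pS.
have [f [fS fr fmin]] := minimal_sublinear_ex rS.
exists f; split=> [|x|]; first exact: minimal_sublinear_linear.
  exact: le_trans (fr x) (rp x).
by have := sublinearN x0 fS; have := fr (- x0); lra.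
Qed.

End sublinear_theory.

(** * Convex sets, bounded functionals and separation *)

Lemma convex_setP (R : realType) (X : lmodType R) (P : set X) (x y : X) (t : R) :
  convex_set P -> P x -> P y -> 0 <= t <= 1 -> P (t *: x + (1 - t) *: y).
Proof.
move=> cP Px Py /andP[t0 t1].
by have /set_mem := cP x y (Itv01 t0 t1) (mem_set Px) (mem_set Py).
Qed.

Lemma cdual_ex (R : realType) (X : normedModType R) (f : X -> R) (K : R) :
  linear (f : X -> R^o) -> (forall x, `|f x| <= K * `|x|) ->
  exists g : cdual X, forall x, g x = f x.
Proof.
move=> lf fK.
pose F : {linear X -> R^o} :=
  HB.pack (f : X -> R^o) (GRing.isLinear.Build _ _ _ _ _ lf).
have cf : continuous (f : X -> R^o).
  apply: (@linear_bounded_continuous R X R^o F).1.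
  apply/linear_boundedP; exists K; split; first exact: num_real.
  move=> k Kk x; apply: le_trans (fK x) _.
  by apply: ler_wpM2r => //; exact: ltW.
have fP : (f : X -> R^o) \in @cdual_pred R X by rewrite inE.
by exists (CDual fP).
Qed.

Lemma cdual_bounded (R : realType) (X : normedModType R) (f : cdual X) x :
  `|f x| <= `|f| * `|x|.
Proof.
have [->|x0] := eqVneq x 0; first by rewrite cdual0r !normr0 mulr0.
have nx0 : 0 < `|x| by rewrite normr_gt0.
rewrite -ler_pdivrMr// -[leLHS]mulrC -(normr_id x) -normfV.
rewrite -normrM -cdualZr; apply: cdual_norm_ub.
by rewrite normrZ normfV normr_id mulVf// gt_eqF.
Qed.

(* The separating functional minorizes v |-> inf (t + (2 / r) |v - t z|), over
   t >= 0 and z in P, where r is the radius of a ball around x missing P: this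
   infimum is at most 1 on P and exceeds 1 at x. *)
Lemma closed_convex_separation (R : realType) (X : normedModType R)
    (P : set X) (x : X) :
  closed P -> convex_set P -> P 0 -> ~ P x ->
  exists2 f : cdual X, 1 < f x & forall z, P z -> f z <= 1.
Proof.
move=> clP cP P0 Px.
have [r r0 rP] : exists2 r : R, 0 < r & forall z, P z -> r <= `|x - z|.
  have := closed_openC clP; rewrite openE => /(_ x Px) /nbhs_ballP[r /= r0 rP].
  exists r => // z Pz; rewrite leNgt; apply/negP => xz.
  by apply: (rP z) => //; rewrite -ball_normE.
(* With this slope the distance term is at least 2 at any point as far from [x] as [P] is. *)
pose K := 2 / r.
have K0 : 0 < K by rewrite divr_gt0.
have Kr : K * r = 2 by rewrite /K divfK// gt_eqF.
pose D := [set tz : R * X | 0 <= tz.1 /\ P tz.2].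
pose F (tz : R * X) v := tz.1 + K * `|v - tz.1 *: tz.2|.
have DP t z : 0 <= t -> P z -> D (t, z) by [].
have D0 : D !=set0 by exists (0, 0); exact: DP.
have Flb v : has_lbound [set F i v | i in D].
  by exists 0 => _ [[t z] [/= t0 _] <-]; rewrite addr_ge0// mulr_ge0// ltW.
pose p := inf_family D F.
have pS : sublinear p.
  apply: inf_family_sublinear => //.
    move=> [s z] [t w] u v [/= s0 Pz] [/= t0 Pw].
    (* The weights [s / (s + t)] of the convex combination need a nonzero sum; otherwise both
       coefficients vanish. *)
    have [st0|st0] := eqVneq (s + t) 0.
      have [-> ->] : s = 0 /\ t = 0 by split; lra.
      exists (0, 0); first exact: DP.
      rewrite /F /= !scale0r !subr0 !add0r -mulrDr.
      by rewrite (ler_wpM2l (ltW K0)) ?ler_normD.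
    have stp : 0 < s + t by rewrite lt_neqAle eq_sym st0 addr_ge0.
    exists (s + t, (s / (s + t)) *: z + (1 - s / (s + t)) *: w).
      apply: DP; first exact: addr_ge0.
      apply: convex_setP => //; rewrite divr_ge0 ?addr_ge0//=.
      by rewrite ler_pdivrMr// mul1r lerDl.
    have stE : (s + t) *: ((s / (s + t)) *: z + (1 - s / (s + t)) *: w)
        = s *: z + t *: w.
      rewrite scalerDr !scalerA; congr (_ *: _ + _ *: _); by field.
    rewrite /F /= stE opprD addrACA [leRHS]addrACA lerD2l -mulrDr.
    by rewrite (ler_wpM2l (ltW K0)) ?ler_normD.
  move=> [s z] t v [/= s0 Pz] t0; exists (t * s, z).
    by apply: DP => //; rewrite mulr_ge0// ltW.
  rewrite /F /= -scalerA -scalerBr normrZ gtr0_norm//; lra.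
have p_norm v : p v <= K * `|v|.
  have := inf_family_le Flb v (DP 0 0 (lexx _) P0).
  by rewrite /F /= scale0r subr0 add0r.
have pP z : P z -> p z <= 1.
  move=> Pz; have := inf_family_le Flb z (DP 1 z ler01 Pz).
  by rewrite /F /= scale1r subrr normr0 mulr0 addr0.
pose N := `|x| + 1.
have N0 : 0 < N by rewrite ltr_wpDl.
(* The margin of separation: if [t - 1 < e], then [(t - 1) * N <= r / 2], and the distance term is
   still at least 1. *)
pose e := Num.min 1 (r / (2 * N)).
have e0 : 0 < e by rewrite lt_min ltr01 divr_gt0// mulr_gt0.
have px : 1 + e <= p x.
  apply: le_inf_family => // -[t z] [/= t0 Pz]; rewrite /F /=.
  (* For [t <= 1] the point [t *: z] is in [P] and the distance term is at least 2. For [t >= 1 + e]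
     the term [t] suffices. In between, [t *: z] stays close enough to [z]. *)
  have [t1|t1] := leP t 1.
    have /rP rz : P (t *: z).
      by have := convex_setP cP Pz P0 (t := t); rewrite scaler0 addr0 t0 t1; exact.
    have : K * r <= K * `|x - t *: z| by rewrite (ler_wpM2l (ltW K0)).
    have : e <= 1 by rewrite ge_min lexx.
    by rewrite Kr; lra.
  have h1 : `|t *: (x - z)| - `|(t - 1) *: x| <= `|x - t *: z|.
    rewrite lerBlDr; apply: le_trans (ler_normD _ _).
    rewrite (_ : x - _ + _ = t *: (x - z))//.
    by rewrite scalerBr scalerBl scale1r [LHS]addrC addrA subrK.
  rewrite !normrZ (gtr0_norm (lt_trans ltr01 t1)) in h1.
  rewrite (gtr0_norm (_ : 0 < t - 1)) ?subr_gt0// in h1.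
  have h2 : r - (t - 1) * N <= `|x - t *: z|.
    have := rP z Pz; have : (t - 1) * `|x| <= (t - 1) * N.
      by rewrite ler_wpM2l ?lerDl// subr_ge0 ltW.
    have : `|x - z| <= t * `|x - z| by rewrite ler_peMl// ltW.
    lra.
  have [et|et] := leP e (t - 1).
    have : 0 <= K * `|x - t *: z| by rewrite mulr_ge0// ltW.
    lra.
  have : K * (r - (t - 1) * N) <= K * `|x - t *: z| by rewrite (ler_wpM2l (ltW K0)).
  have : (t - 1) * N <= r / 2.
    rewrite -ler_pdivlMr//; apply: le_trans (ltW et) _.
    by rewrite /e ge_min invfM mulrA lexx orbT.
  move=> /(ler_wpM2l (ltW K0)); rewrite [K * (r / 2)]mulrA mulrBr Kr.
  have : e <= 1 by rewrite ge_min lexx.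
  by rewrite divff// ?pnatr_eq0//; lra.
have [f [lf fp fx]] := hahn_banach_sublinear x pS.
have fN v : f (- v) = - f v.
  pose G : {linear X -> R^o} :=
    HB.pack (f : X -> R^o) (GRing.isLinear.Build _ _ _ _ _ lf).
  exact: (linearN G).
have [g gf] : exists g : cdual X, forall x, g x = f x.
  apply: (cdual_ex (K := K)) => // v; rewrite ler_norml.
  rewrite (le_trans (fp v) (p_norm v)) andbT.
  by rewrite lerNl -fN -(normrN v) (le_trans (fp _)).
exists g => [|z Pz]; rewrite gf; last exact: le_trans (fp z) (pP z Pz).
by apply: lt_le_trans fx; apply: lt_le_trans px; rewrite ltrDl.
Qed.

(** * Weak limits along ultrafilters in reflexive spaces *)

Lemma bounded_ultra_cvg (R : realType) (I : Type) (U : set_system I) (h : I -> R)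
    (M : R) :
  UltraFilter U -> (forall i, `|h i| <= M) -> cvg (h i @[i --> U]).
Proof.
move=> UU hM.
have [p [_ cp]] : `[- M, M]%classic `&` cluster (h i @[i --> U]) !=set0.
  apply: segment_compact; apply: (@filterS _ U _ setT); last exact: filterT.
  by move=> i _ /=; rewrite in_itv /= -ler_norml hM.
apply/cvg_ex; exists p => A Ap.
(* The ultrafilter contains the preimage of the neighbourhood [A] or of its complement; the latter
   is excluded because [p] is a cluster point. *)
have [//|UA] := in_ultra_setVsetC (h @^-1` A) UU.
by have [q [nAq Aq]] := cp (~` A) A UA Ap.
Qed.

(* The limits along the ultrafilter of the bounded scalar sequences f (u n) form a
   continuous functional of f, which reflexivity represents by a point. *)
Lemma reflexive_weak_ultra_cvg (R : realType) (X : normedModType R) (I : Type)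
    (U : set_system I) (u : I -> X) (M : R) :
  reflexive_space X -> UltraFilter U -> (forall i, `|u i| <= M) ->
  exists x, forall f : cdual X, (f (u i) : R) @[i --> U] --> (f x : R).
Proof.
move=> reflX UU uM.
have fM (f : cdual X) i : `|f (u i)| <= `|f| * M.
  by apply: le_trans (cdual_bounded f (u i)) _; rewrite ler_wpM2l.
have cvf (f : cdual X) : cvg ((f (u i) : R) @[i --> U]).
  exact: bounded_ultra_cvg (fM f).
pose phi (f : cdual X) : R := lim ((f (u i) : R) @[i --> U]).
have phiE (f : cdual X) : (f (u i) : R) @[i --> U] --> phi f by exact: cvf.
have lphi : linear (phi : cdual X -> R^o).
  move=> t f g; apply: (cvg_unique (@norm_hausdorff R R^o) (phiE _)).
  apply: (@cvgD R R^o _ U); last exact: phiE.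
  apply: (@cvgZl_tmp R R^o _ U); exact: phiE.
have phiM f : `|phi f| <= M * `|f|.
  rewrite mulrC ler_norml; apply/andP; split.
    apply: limr_ge; first exact: cvf.
    by apply: nearW => i; have := fM f i; rewrite ler_norml => /andP[].
  apply: limr_le; first exact: cvf.
  by apply: nearW => i; have := fM f i; rewrite ler_norml => /andP[].
have [Phi PhiE] := cdual_ex lphi phiM.
by have [x xE] := reflX Phi; exists x => f; rewrite -xE PhiE; exact: phiE.
Qed.

(** * Hilbert space: variational inequality and Riesz representation *)

Section hilbert.
Context {R : realType} {Y : completeNormedModType R} (dotY : {dot Y for idfun}).
Hypothesis normY : forall y : Y, `|y| = Num.sqrt (dotY y y).
Implicit Types x y z : Y.

Lemma dotDl x y z : dotY (x + y) z = dotY x z + dotY y z.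
Proof. exact: (linearDl dotY z). Qed.

Lemma dotZl t x z : dotY (t *: x) z = t * dotY x z.
Proof. exact: (linearZl_LR dotY z). Qed.

Lemma dotC x y : dotY x y = dotY y x.
Proof. by rewrite (hermC dotY) expr0 mul1r. Qed.

Lemma dotBl x y z : dotY (x - y) z = dotY x z - dotY y z.
Proof. exact: (linearBl dotY z). Qed.

Lemma dotDr x y z : dotY z (x + y) = dotY z x + dotY z y.
Proof. exact: (linearDr dotY z). Qed.

Lemma dotBr x y z : dotY z (x - y) = dotY z x - dotY z y.
Proof. exact: (linearBr dotY z). Qed.

Lemma dotZr t x z : dotY z (t *: x) = t * dotY z x.
Proof. exact: (linearZr_LR dotY z). Qed.

Lemma dot_normE y : dotY y y = `|y| ^+ 2.
Proof.
rewrite normY sqr_sqrtr//; have [->|y0] := eqVneq y 0.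
  by rewrite (linear0r dotY).
by rewrite ltW//; exact: neq0_dnorm_gt0.
Qed.

Lemma dot_cauchy_schwarz x y : `|dotY x y| <= `|x| * `|y|.
Proof.
have [->|y0] := eqVneq y 0; first by rewrite (linear0r dotY) !normr0 mulr0.
have yy0 : 0 < `|y| ^+ 2 by rewrite exprn_gt0// normr_gt0.
rewrite -ler_sqr ?nnegrE ?mulr_ge0// exprMn real_normK ?num_real//.
(* The projection coefficient of [x] on [y]: the orthogonal remainder has nonnegative squared
   norm. *)
pose t := dotY x y / `|y| ^+ 2.
have : 0 <= dotY (x - t *: y) (x - t *: y) by rewrite dot_normE sqr_ge0.
rewrite dotBl !dotBr !dotZl !dotZr (dotC y x) !dot_normE -(pmulr_lge0 _ yy0).
rewrite (_ : _ * _ = `|x| ^+ 2 * `|y| ^+ 2 - dotY x y ^+ 2); first by rewrite subr_ge0.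
by rewrite /t; field; rewrite normr_eq0.
Qed.

(* The minimizer over C of |y|^2 - 2 f y: minimizing sequences are Cauchy by the
   parallelogram identity. *)
Lemma convex_variational_inequality (C : set Y) (f : Y -> R) (M : R) :
  closed C -> convex_set C -> C !=set0 ->
  linear (f : Y -> R^o) -> (forall y, `|f y| <= M * `|y|) ->
  exists2 y, C y & forall z, C z -> f z - f y <= dotY y (z - y).
Proof.
move=> clC cC [c0 Cc0] lf fM.
pose F : {linear Y -> R^o} :=
  HB.pack (f : Y -> R^o) (GRing.isLinear.Build _ _ _ _ _ lf).
have fD x y : f (x + y) = f x + f y by exact: (linearD F).
have fB x y : f (x - y) = f x - f y by exact: (linearB F).
have fZ t y : f (t *: y) = t * f y by exact: (linearZ_LR F).
have cf : continuous (f : Y -> R^o).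
  apply: (@linear_bounded_continuous R Y R^o F).1.
  apply/linear_boundedP; exists M; split; first exact: num_real.
  move=> k Mk x; apply: le_trans (fM x) _.
  by apply: ler_wpM2r => //; exact: ltW.
pose J y := `|y| * `|y| - 2 * f y.
have JE y : J y = dotY y y - 2 * f y by rewrite /J dot_normE expr2.
have Jlb : has_inf [set J y | y in C].
  split; first by exists (J c0), c0.
  (* Completing the square: [J y] is at least [(|y| - M)^2 - M^2]. *)
  exists (- M ^+ 2) => _ [y Cy <-]; rewrite /J -expr2.
  have := sqr_ge0 (`|y| - M); have := fM y.
  by rewrite ler_norml => /andP[_]; rewrite sqrrB; lra.
pose m := inf [set J y | y in C].
have mJ y : C y -> m <= J y.
  by move=> Cy; apply: ge_inf; [exact: Jlb.2|exists y].
have [y yP] : {y : nat -> Y & forall n, C (y n) /\ J (y n) < m + n.+1%:R^-1}.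
  apply: (@choice _ _ (fun n y => C y /\ J y < m + n.+1%:R^-1)) => n.
  have n0 : 0 < n.+1%:R^-1 :> R by rewrite invr_gt0.
  by have [_ [y Cy <-] Jy] := inf_adherent n0 Jlb; exists y.
(* The value of [J] at the midpoint is [(J u + J v) / 2 - |u - v|^2 / 4], and it is at least [m]. *)
have par u v : C u -> C v -> `|u - v| ^+ 2 <= 2 * (J u - m) + 2 * (J v - m).
  move=> Cu Cv; have Cuv : C (2^-1 *: u + (1 - 2^-1) *: v).
    by apply: convex_setP => //; lra.
  have := mJ _ Cuv; rewrite !JE -dot_normE dotBl !dotBr.
  rewrite !(dotDl, dotDr, dotZl, dotZr, fD, fZ) (dotC v u).
  lra.
have cvy : cvg (y n @[n --> \oo]).
  apply/cauchy_cvgP/cauchy_exP => e e0.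
  have e40 : 0 < e ^+ 2 / 4 by rewrite divr_gt0// exprn_gt0.
  have [N _ NP] := near_infty_natSinv_lt (PosNum e40).
  exists (y N); exists N => // n /= Nn.
  rewrite -ball_normE /= -ltr_sqr ?nnegrE//; last exact: ltW.
  have := par (y N) (y n) (yP N).1 (yP n).1.
  have := (yP N).2; have := (yP n).2.
  have := NP N (leqnn N); have := NP n Nn; rewrite /=.
  by move: (n.+1%:R^-1) (N.+1%:R^-1) => a b; lra.
pose w := lim (y n @[n --> \oo]).
have yw : y n @[n --> \oo] --> w by exact: cvy.
have Cw : C w.
  by apply: (closed_cvg C clC _ _ yw); apply: nearW => n; case: (yP n).
have Jw : J w <= m.
  apply/ler_addgt0Pr => e e0.
  have JJ : J (y n) @[n --> \oo] --> J w.
    apply: cvgB; first by apply: cvgM; exact: cvg_norm.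
    by apply: cvgMl_tmp; apply: (cvg_comp _ _ yw); exact: cf.
  apply: (closed_cvg (fun v => v <= m + e) (@closed_le _ _) _ _ JJ).
  have [N _ NP] := near_infty_natSinv_lt (PosNum e0).
  exists N => // n Nn /=; apply/ltW/(lt_trans (yP n).2).
  by rewrite ltrD2l; exact: NP.
exists w => // z Cz; rewrite leNgt; apply/negP.
set A := dotY w (z - w); set B := f z - f w => AB.
pose D := `|z - w| ^+ 2.
have D0 : 0 <= D by rewrite sqr_ge0.
(* Moving from [w] towards [z] by [t] changes [J] by [t * (2 * A + t * D - 2 * B)]. This [t] lies in
   [[0, 1]] and makes [t * D < B - A], so the change would be negative. *)
pose t := (B - A) / (D + (B - A) + 1).
have den0 : 0 < D + (B - A) + 1 by lra.
have tE : t * (D + (B - A) + 1) = B - A by rewrite /t divfK// gt_eqF.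
have t0 : 0 < t by rewrite divr_gt0//; lra.
have t1 : t <= 1 by rewrite ler_pdivrMr//; lra.
have Ct : C (t *: z + (1 - t) *: w).
  by apply: convex_setP => //; rewrite t1 ltW.
have := le_trans Jw (mJ _ Ct).
rewrite (_ : _ *: _ + _ = w + t *: (z - w)); last first.
  by rewrite scalerBl scale1r scalerBr addrA addrAC addrC addrA.
rewrite !JE fD fZ fB -/B (dotDl w) !(dotDr w) !dotZl !dotZr (dotC (z - w) w).
rewrite (dot_normE (z - w)) -/A -/D => H.
have : 0 <= t * (2 * A + t * D - 2 * B) by lra.
rewrite pmulr_rge0//.
have := mulr_gt0 t0 (_ : 0 < B - A + 1); lra.
Qed.

(** Over the whole space the variational inequality at [w + z] reads [f z <= dotY w z]; replacing
    [z] by [- z] gives equality. *)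
Lemma riesz_representation (f : Y -> R) (M : R) :
  linear (f : Y -> R^o) -> (forall y, `|f y| <= M * `|y|) ->
  exists w, forall y, f y = dotY w y.
Proof.
move=> lf fM.
have cT : convex_set (setT : set (convex_lmodType Y)) by move=> *; rewrite inE.
have [//|w _ wP] := convex_variational_inequality closedT cT _ lf fM.
  by exists 0.
have wf z : f z <= dotY w z.
  have := wP (w + z) I; rewrite addrAC subrr add0r.
  by have := lf 1 w z; rewrite !scale1r => ->; rewrite addrAC subrr add0r.
exists w => y; apply/eqP; rewrite eq_le wf /=.
have := wf (- y); rewrite -scaleN1r dotZr.
have /(_ (-1) y 0) := lf.
have f0 : f 0 = 0 by have := fM 0; rewrite normr0 mulr0 normr_le0 => /eqP.
by rewrite !addr0 f0 => ->; rewrite -[_ *: f y]/(_ * _); lra.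
Qed.

End hilbert.

(** * Bounded bilinear forms and closedness of the image *)

Lemma continuous_bilinear_bounded (R : realType) (X Y : normedModType R)
    (a : {bilinear X -> Y -> R^o}) :
  continuous (fun p : X * Y => a p.1 p.2) ->
  exists2 K, 0 < K & forall x y, `|a x y| <= K * (`|x| * `|y|).
Proof.
move=> ca.
have [e e0 eP] : exists2 e : R, 0 < e &
    forall x y, `|x| < e -> `|y| < e -> `|a x y| < 1.
  have /cvgrPdist_lt/(_ 1 ltr01)/nbhs_ballP[e /= e0 eP] := ca (0, 0).
  exists e => // x y xe ye.
  have := eP (x, y); rewrite /= (linear0l a) sub0r normrN; apply.
  by split; rewrite -ball_normE /= sub0r normrN.
(* Dividing [v] by [s * |v|] gives norm [e / 2], strictly inside the ball of continuity at the
   origin. *)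
pose s := 2 / e.
have s0 : 0 < s by rewrite divr_gt0.
exists (s ^+ 2) => [|x y]; first exact: exprn_gt0.
have [->|x0] := eqVneq x 0; first by rewrite (linear0l a) !normr0 mul0r mulr0.
have [->|y0] := eqVneq y 0; first by rewrite (linear0r a) !normr0 !mulr0.
have nx : 0 < s * `|x| by rewrite mulr_gt0// normr_gt0.
have ny : 0 < s * `|y| by rewrite mulr_gt0// normr_gt0.
have scaled_lt (V : normedModType R) (v : V) : v != 0 -> `|(s * `|v|)^-1 *: v| < e.
  move=> v0; have nv : 0 < `|v| by rewrite normr_gt0.
  have sv : 0 < (s * `|v|)^-1 by rewrite invr_gt0 mulr_gt0.
  rewrite normrZ gtr0_norm// invfM -mulrA mulVf ?gt_eqF// mulr1 /s invf_div.
  by rewrite ltr_pdivrMr// mulr_natr mulr2n ltrDl.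
have xe := scaled_lt _ _ x0; have ye := scaled_lt _ _ y0.
have := eP _ _ xe ye.
rewrite (linearZl_LR a) (linearZr_LR a) /GRing.scale/= !normrM !normfV.
rewrite (gtr0_norm nx) (gtr0_norm ny) ltr_pdivrMl// ltr_pdivrMl// mulr1.
by move/ltW/le_trans; apply; rewrite mulrACA expr2 [_ * `|x|]mulrC.
Qed.

Section closed_image.
Context {R : realType} {X : normedModType R} {Y : completeNormedModType R}.
Context (dotY : {dot Y for idfun}).
Hypothesis normY : forall y : Y, `|y| = Num.sqrt (dotY y y).

Lemma dot_inj (u v : Y) : (forall y, dotY u y = dotY v y) -> u = v.
Proof.
move=> uv; apply/eqP; rewrite -subr_eq0 -normr_eq0 -sqrf_eq0.
by rewrite -(dot_normE normY) dotBl uv subrr.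
Qed.

(* Preimages of a convergent sequence are bounded, because the cone part is
   controlled by its image, so they have a weak limit. *)
Lemma closed_image_split (P PA PC : set X) (T : X -> Y) (K M c : R) :
  reflexive_space X -> closed P -> convex_set P -> P 0 ->
  (forall x, PA x -> `|x| <= M) ->
  (forall x, P x -> exists xA xC, [/\ PA xA, PC xC & x = xA + xC]) ->
  linear T -> (forall x, `|T x| <= K * `|x|) ->
  0 < c -> 0 <= K -> (forall x, PC x -> c * `|x| <= `|T x|) ->
  closed (T @` P).
Proof.
move=> reflX clP cP P0 PAM split_P lT TK c0 K0 PCc g clg.
have [u uP] : {u : nat -> X & forall n, P (u n) /\ `|g - T (u n)| < n.+1%:R^-1}.
  apply: (@choice _ _ (fun n x => P x /\ `|g - T x| < n.+1%:R^-1)) => n.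
  have n0 : 0 < n.+1%:R^-1 :> R by rewrite invr_gt0.
  have [_ [[x Px <-]]] := clg _ (nbhsx_ballx g _ n0).
  by rewrite -ball_normE => gx; exists x.
have TD x y : T (x + y) = T x + T y.
  by have := lT 1 x y; rewrite !scale1r.
have M0 : 0 <= M.
  have [xA [_ [/PAM xAM _ _]]] := split_P 0 P0; exact: le_trans xAM.
(* [M] bounds the part in [PA]. The image of the cone part is [g - (g - T (u n)) - T xA], of norm at
   most [|g| + 1 + K * M]. *)
pose B := M + c^-1 * (`|g| + 1 + K * M).
have uB n : `|u n| <= B.
  have [Pu gu] := uP n; have [xA [xC [/PAM xAM /PCc xCc uE]]] := split_P _ Pu.
  rewrite {1}uE; apply: le_trans (ler_normD _ _) _; apply: lerD => //.
  rewrite ler_pdivlMl//; apply: le_trans xCc _.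
  have -> : T xC = g - (g - T (u n)) - T xA.
    by rewrite uE TD subKr addrC addKr.
  apply: le_trans (ler_normB _ _) _; apply: lerD; last first.
    by apply: le_trans (TK xA) _; rewrite ler_wpM2l.
  apply: le_trans (ler_normB _ _) _; rewrite lerD2l.
  apply/ltW/(lt_le_trans gu); rewrite invf_le1 ?ler1n//; exact: ltr0n.
(* An ultrafilter finer than the tail filter plays the role of a weakly convergent subsequence. *)
have [U [UU sU]] := ultraFilterLemma (eventually_filter : ProperFilter \oo).
have [x ux] := reflexive_weak_ultra_cvg reflX UU uB.
have Tug : T (u n) @[n --> U] --> g.
  apply: (@cvg_trans _ (T (u n) @[n --> \oo])).
    by move=> A; exact: sU.
  apply/cvgrPdist_lt => e e0.
  have [N _ NP] := near_infty_natSinv_lt (PosNum e0).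
  by exists N => // n Nn /=; apply: lt_trans (uP n).2 _; exact: NP.
exists x.
  apply: contrapT => Px; have [f fx fP] := closed_convex_separation clP cP P0 Px.
  have : f x <= 1 :> R.
    apply: (closed_cvg (fun v : R => v <= 1) (@closed_le _ _) _ _ (ux f)).
    by apply: nearW => n; apply: fP; case: (uP n).
  by rewrite leNgt fx.
(* Tested against [y], the images converge to [dotY (T x) y] by weak convergence and to [dotY g y]
   by norm convergence. *)
apply: dot_inj => y.
have [f fE] : exists f : cdual X, forall v, f v = dotY (T v) y.
  apply: (cdual_ex (K := K * `|y|)) => [t v w|v].
    by rewrite lT (dotDl dotY) (dotZl dotY).
  apply: le_trans (dot_cauchy_schwarz normY _ _) _.
  by rewrite mulrAC ler_wpM2r.
have [h hE] : exists h : cdual Y, forall v, h v = dotY v y.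
  apply: (cdual_ex (K := `|y|)) => [t v w|v].
    by rewrite (dotDl dotY) (dotZl dotY).
  by rewrite mulrC; exact: dot_cauchy_schwarz normY _ _.
have ch : continuous (h : Y -> R^o) by have := valP h; rewrite inE => -[].
rewrite -fE -hE; apply: (cvg_unique (@norm_hausdorff R R^o) (ux f)).
rewrite (_ : (fun n => f (u n)) = h \o (T \o u)); last first.
  by apply/funext => n /=; rewrite fE hE.
exact: (cvg_comp _ _ Tug (ch g)).
Qed.

End closed_image.

(** * Weak duality and lower bounds from dual solutions *)

Lemma lambda_star_le_zeta_star (R : realType) (X Y : normedModType R)
    (a : X -> Y -> R) (L : Y -> R) (P : set X) :
  (lambda_star a L P <= zeta_star a L P)%E.
Proof.
apply/ereal_supP => _ [x Px <-]; apply/ereal_infP => _ [y Ly <-].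
apply: (@le_trans _ _ (a x y)%:E).
  by apply: ge_ereal_inf; exists (a x y)%:E => //; exists y.
by apply: ereal_sup_ubound; exists x.
Qed.

(** On the constraint [L y = 1] the form is constantly [l], so [x] competes in the outer supremum
    with value at least [l]. *)
Lemma lambda_star_ge (R : realType) (X Y : normedModType R)
    (a : X -> Y -> R) (L : Y -> R) (P : set X) (x : X) (l : R) :
  P x -> (forall y, a x y = l * L y) -> (l%:E <= lambda_star a L P)%E.
Proof.
move=> Px axy; apply: le_ereal_sup_tmp.
exists (ereal_inf [set (a x y)%:E | y in [set y | L y = 1]]); first by exists x.
by apply/ereal_infP => _ [y Ly <-]; rewrite axy Ly mulr1.
Qed.

(** * Solvability at every real level between 0 and [zeta_star] *)

Section minimax.
Context {R : realType} {X Y : completeNormedModType R}.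
Hypothesis X_reflexive : reflexive_space X.
Context (dotY : {dot Y for idfun}).
Hypothesis normY : forall y : Y, `|y| = Num.sqrt (dotY y y).
Context (a : {bilinear X -> Y -> R^o}) (L : {linear Y -> R^o}).
Hypothesis a_cont : continuous (fun p : X * Y => a p.1 p.2).
Hypothesis L_cont : continuous L.
Context (P PA PC : set X).
Hypotheses (P_closed : closed P) (P_convex : convex_set P) (P0 : P 0).
Hypothesis PA_bounded : bounded_set PA.
Hypothesis P_split :
  forall x, P x -> exists xA xC, [/\ PA xA, PC xC & x = xA + xC].
Hypothesis cstar_gt0 : (0 < infsup_const a PC)%E.

(* Projecting l L onto the image of P in the dual of Y leaves a residual w; if w
   did not vanish, w / L w would be a competitor bringing zeta_star below l. *)
Lemma zeta_star_solution (l : R) : 0 <= l -> (l%:E <= zeta_star a L P)%E ->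
  exists2 x, P x & forall y, a x y = l * L y.
Proof.
move=> l0 lz.
have [K K0 aK] := continuous_bilinear_bounded a_cont.
have [M _ PAM] := pinfty_ex_gt0 PA_bounded.
have [T TE] : {T : X -> Y & forall x y, a x y = dotY (T x) y}.
  apply: (@choice _ _ (fun x w => forall y, a x y = dotY w y)) => x.
  apply: (riesz_representation normY (M := K * `|x|)) => [t v w|y].
    exact: (linearPr a).
  by rewrite -mulrA.
have [ML _ LM] : exists2 M, 0 < M & forall y, `|L y| <= M * `|y|.
  apply: pinfty_ex_gt0; apply/linear_boundedP.
  exact/linear_bounded_continuous.
have [e eE] : exists e, forall y, L y = dotY e y.
  by apply: (riesz_representation normY (M := ML)) => // t v w; exact: linearP.
have lT : linear T.
  move=> t u v; apply: (dot_inj normY) => y.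
  by rewrite (dotDl dotY) (dotZl dotY) -!TE (linearPl a).
have TK x : `|T x| <= K * `|x|.
  have [->|Tx0] := eqVneq (T x) 0; first by rewrite normr0 mulr_ge0// ltW.
  have nT : 0 < `|T x| by rewrite normr_gt0.
  rewrite -(ler_pM2r nT) -mulrA -expr2 -(dot_normE normY) -TE.
  exact: le_trans (ler_norm _) (aK _ _).
(* The inf-sup constant may be [+oo], for instance when [PC] has no nonzero element; then 1 serves
   as a finite lower bound. *)
have [c c0 cc] : exists2 c : R, 0 < c & (c%:E <= infsup_const a PC)%E.
  move: cstar_gt0; case: (infsup_const a PC) => [c|_|]//.
    by rewrite lte_fin => c0; exists c.
  by exists 1; rewrite ?leey.
have PCc x : PC x -> c * `|x| <= `|T x|.
  move=> PCx; have [->|x0] := eqVneq x 0; first by rewrite normr0 mulr0.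
  have nx : 0 < `|x| by rewrite normr_gt0.
  rewrite -ler_pdivlMr// -lee_fin; apply: le_trans cc _.
  apply: ge_ereal_inf; eexists; first by exists x => //; split=> //; exact/eqP.
  apply/ereal_supP => _ [y /eqP y0 <-]; rewrite lee_fin invfM mulrA.
  have ny : 0 < `|y| by rewrite normr_gt0.
  rewrite ler_pdivrMr// mulrAC ler_pM2r ?invr_gt0// TE.
  exact: le_trans (ler_norm _) (dot_cauchy_schwarz normY _ _).
have clT : closed (T @` P).
  apply: (closed_image_split normY (PA := PA) (PC := PC)
    (M := M) (K := K) (c := c)) => //; exact: ltW.
have cT : convex_set (T @` P).
  move=> _ _ k /set_mem[x Px <-] /set_mem[y Py <-]; apply/mem_set.
  exists (k%:num *: x + (1 - k%:num) *: y).
    by apply: convex_setP => //; rewrite ge0 le1.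
  rewrite lT; congr (_ + _).
  have := lT (1 - k%:num) y 0; rewrite addr0 => ->.
  have := lT 1 0 0; rewrite !scale1r addr0 -[LHS]addr0 => /addrI <-.
  by rewrite addr0.
(* For the functional [l * L], represented by [l *: e], the inequality says that [T x] is the
   projection of [l *: e] on the image of [P]. *)
have [|||_ [x Px <-] xP] :=
  convex_variational_inequality (f := fun y => l * L y) (M := l * ML) normY clT cT.
- by exists (T 0), 0.
- move=> t v w; rewrite linearP mulrDr; congr (_ + _).
  by rewrite /GRing.scale/= mulrCA.
- by move=> y; rewrite normrM ger0_norm// -mulrA ler_wpM2l.
exists x => // y; rewrite TE eE -(dotZl dotY); congr (dotY _ _).
apply/eqP; rewrite eq_sym -subr_eq0; apply/negPn/negP.
set w := l *: e - T x => w0.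
have ww : 0 < dotY w w by exact: neq0_dnorm_gt0.
(* The projection inequality gives [dotY (T v) w <= dotY (T x) w], and [T x = l *: e - w]. *)
have aw v : P v -> a v w <= l * L w - dotY w w.
  move=> Pv; have TPv : (T @` P) (T v) by exists v.
  have wE u : dotY u w = l * dotY u e - dotY u (T x).
    by rewrite /w (dotBr dotY) (dotZr dotY).
  have -> : dotY w w = l * L w - dotY (T x) w.
    by rewrite eE {1}/w (dotBl dotY) (dotZl dotY).
  have := xP _ TPv; rewrite TE !wE !eE (dotBr dotY) !(dotC dotY e).
  by rewrite (dotC dotY (T v) (T x)); lra.
(* At [v = 0] the bound reads [dotY w w <= l * L w], so [l * L w] is positive while [l >= 0]. *)
have Lw : 0 < L w.
  have := aw 0 P0; rewrite (linear0l a) => lLw.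
  have : 0 < l * L w by lra.
  by move=> h; rewrite ltNge; apply/negP => Lw; have := mulr_ge0_le0 l0 Lw; lra.
have : (zeta_star a L P <= (l - dotY w w / L w)%:E)%E.
  apply: ge_ereal_inf; eexists.
    exists ((L w)^-1 *: w); last by [].
    by rewrite /= linearZ_LR /GRing.scale/= mulVf// gt_eqF.
  apply/ereal_supP => _ [v Pv <-]; rewrite lee_fin (linearZr_LR a) /GRing.scale/=.
  rewrite ler_pdivrMl//; apply: le_trans (aw v Pv) _.
  by rewrite mulrBr [L w * (_ / _)]mulrC divfK ?gt_eqF// [L w * l]mulrC.
move=> /(le_trans lz); rewrite lee_fin; apply/negP; rewrite -ltNge.
by rewrite ltrBlDr ltrDl divr_gt0.
Qed.

End minimax.

Theorem theorem2p3 (R : realType)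
    (X : completeNormedModType R) (X_reflexive : reflexive_space X)
    (Y : completeNormedModType R) (dotY : {dot Y for idfun})
    (normY : forall y : Y, `|y| = Num.sqrt (dotY y y))
    (a : {bilinear X -> Y -> R^o})
    (a_cont : continuous (fun p : X * Y => a p.1 p.2))
    (L : {linear Y -> R^o}) (L_cont : continuous L)
    (L_neq0 : (L : Y -> R) <> cst 0)
    (P : set X) (P_closed : closed P) (P_convex : convex_set P) (P0 : P 0)
    (PA : set X) (PA_closed : closed PA) (PA_convex : convex_set PA)
    (PA_bounded : bounded_set PA)
    (PC : set X) (PC_sub : PC `<=` P)
    (PC_closed : closed PC) (PC_convex : convex_set PC) (PC_cone : cone PC)
    (P_split : forall x, P x -> exists xA xC, [/\ PA xA, PC xC & x = xA + xC])
    (cstar : \bar R) (cstarE : infsup_const a PC = cstar)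
    (cstar_gt0 : (0 < cstar)%E) :
  lambda_star a L P = zeta_star a L P /\
  ((lambda_star a L P < +oo)%E ->
   exists2 xbar : X, P xbar &
     forall y : Y, (a xbar y)%:E = (lambda_star a L P * (L y)%:E)%E).
Proof.
rewrite -cstarE in cstar_gt0.
have sol := zeta_star_solution X_reflexive normY a_cont L_cont P_closed P_convex
  P0 PA_bounded P_split cstar_gt0.
have lz := lambda_star_le_zeta_star a L P.
(* The origin solves the dual problem at level 0. *)
have l0 : (0 <= lambda_star a L P)%E.
  by apply: (lambda_star_ge P0) => y; rewrite (linear0l a) mul0r.
have [ltoo|] := ltP (lambda_star a L P) +oo%E; last first.
  rewrite leye_eq => /eqP loo; split=> //.
  by move: lz; rewrite loo leye_eq => /eqP.
have [l lE] : exists l, lambda_star a L P = l%:E.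
  by exists (fine (lambda_star a L P)); rewrite fineK// ge0_fin_numE.
rewrite lE lee_fin in l0; rewrite lE in lz *; split.
  apply/eqP; rewrite eq_le lz /= leNgt; apply/negP => zl.
  (* A gap leaves room for a real level above [lambda_star], even if [zeta_star] is infinite; its
     solvability contradicts the supremum. *)
  have [l' ll' l'z] : exists2 l', l < l' & (l'%:E <= zeta_star a L P)%E.
    move: zl; case: (zeta_star a L P) => [r|_|]//.
      by rewrite lte_fin => lr; exists r.
    by exists (l + 1); rewrite ?ltrDl ?leey.
  have [x Px axl] := sol l' (le_trans l0 (ltW ll')) l'z.
  by have := lambda_star_ge Px axl; rewrite lE lee_fin leNgt ll'.
by move=> _; have [x Px axl] := sol l l0 lz; exists x => // y; rewrite axl EFinM.
Qed.
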